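(* There is no social choice function (for facility location on $[0,1]$ with single-peaked preferences and tree-shaped invitation networks) that simultaneously satisfies strategy-proofness over networks (SP), Pareto efficiency (PE), anonymity on distances (AN-D), and $2$-distance voter-relevance (VR-$2$).
   Context: Outcomes and preferences. The outcome set is $\mathcal{O}=[0,1]$. A preference is a complete and transitive binary relation $\succsim$ on $\mathcal{O}$ (strict part $\succ$). It is single-peaked if there is a point $p\in\mathcal{O}$ (its peak) such that for all distinct $x,y\in\mathcal{O}$: if $p\le x<y$ or $y<x\le p$ then $x\succ y$. Let $\mathcal{R}$ be the set of single-peaked preferences. The peak of voter $i$'s preference $\succ_i$ is denoted $p_i$. Networks and types. $\mathcal{N}$ is the set of potential voters and $m\notin\mathcal{N}$ is the moderator. The set $r_m\subseteq\mathcal{N}$ consists of the children of $m$, and for each voter $i$ the set $r_i\subseteq\mathcal{N}\setminus\{i\}$ consists of the children of $i$. Together, $r_m$ and $(r_i)_{i\in\mathcal{N}}$ specify the social network $G$ (a directed edge from each parent to each of its children), which is assumed to be a directed tree with single source $m$. The true type of voter $i$ is $\theta_i=(\succ_i,r_i)$ with $\succ_i\in\mathcal{R}$; $\theta=(\theta_i)_i$ is a type profile and $\theta_{-i}$ is the profile of the types of the voters other than $i$. The set $r_m$ is not part of any type and is not reported by any voter. Reports. A voter with true type $\theta_i=(\succ_i,r_i)$ can report (as her action) any element of $R(\theta_i)=\{(\succ_i',r_i') : \succ_i'\in\mathcal{R},\ r_i'\subseteq r_i\}$. Write $\theta'_{-i}\in R(\theta_{-i})$ if $\theta_j'\in R(\theta_j)$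 for all $j\ne i$, and $\theta'\in R(\theta)$ if $\theta'_j\in R(\theta_j)$ for all $j$. Given a reported profile $\theta'$, the participating voters $\hat N(\theta')$ are those to whom there is a directed path from $m$ in the network formed by $r_m$ and the reported sets $r_i'$. Social choice function (SCF). An SCF $f$ is deterministic and maps each reported profile $\theta'\in R(\theta)$ to an outcome in $\mathcal{O}$, where $f$ can use only the reported preferences and reported children of the participating voters $\hat N(\theta')$. It is defined for every set of participating voters. SP. $f$ is strategy-proof over networks if for any set $N\subseteq\mathcal{N}$ of voters, any $i\in N$, any $\theta_{-i}$, any $\theta'_{-i}\in R(\theta_{-i})$, any $\theta_i=(\succ_i,r_i)$ and any $\theta'_i\in R(\theta_i)$: $f(\theta_i,\theta'_{-i})\succsim_i f(\theta'_i,\theta'_{-i})$. PE. $f$ is Pareto efficient if for every profile $\theta$ there is no outcome $o\in\mathcal{O}$ with $o\succsim_i f(\theta)$ for all participating voters $i$ and $o\succ_i f(\theta)$ for some participating voter $i$. AN-D. Given a social network, let $N_D(d)$ be the set of participating voters at distance $d$ from $m$ (number of edges of the directed path). $f$ satisfies AN-D if for any $\theta$, any integer $d\ge 0$, and any $\theta'$ obtained from $\theta$ by having any subset of the voters in $N_D(d)$ permute their preferences, $f(\theta)=f(\theta')$. VR-$d$. For an integer $d\ge 0$, $f$ is $d$-distance voter-relevant if, for any voter $i\in\bigcup_{1\le d'\le d}N_D(d')$ (the sets $N_D(d')$ being those of the given social network) and any $\theta_i$, there exists a profile $\theta'_{-i}$ of the other voters' actions such that $f(\theta'_i,\theta'_{-i})\ne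 f(\theta''_i,\theta'_{-i})$ for some $\theta'_i,\theta''_i\in R(\theta_i)$.
   Formalization: The formal theorem is stated for every given (finite) social network that has at least one voter at distance 2; without such a voter the claim fails, since choosing the lowest peak among the moderator's children satisfies SP, PE, AN-D and VR-2. *)

(* Defs.v *)
From mathcomp Require Import all_boot all_order all_algebra.
From mathcomp Require Export finmap.
From mathcomp Require Export reals.

Set Implicit Arguments.
Unset Strict Implicit.
Unset Printing Implicit Defensive.

Import Order.TTheory GRing.Theory Num.Theory.

Local Open Scope ring_scope.
Local Open Scope fset_scope.

Definition outcome (R : realType) : Type := {x : R | x \in `[0%R, 1%R]}.

Definition strict (T : Type) (r : T -> T -> Prop) (x y : T) : Prop :=
  r x y /\ ~ r y x.

Definition single_peaked (R : realType)
    (r : outcome R -> outcome R -> Prop) : Prop :=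
  exists p : outcome R, forall x y : outcome R, x <> y ->
    (val p <= val x /\ val x < val y) \/ (val y < val x /\ val x <= val p) ->
    strict r x y.

Record preference (R : realType) : Type := Preference {
  weakly_prefers :> outcome R -> outcome R -> Prop;
  preference_complete :
    forall x y, weakly_prefers x y \/ weakly_prefers y x;
  preference_transitive :
    forall x y z, weakly_prefers x y -> weakly_prefers y z ->
      weakly_prefers x z;
  preference_single_peaked : single_peaked weakly_prefers }.

(* The potential voters form an arbitrary choiceType V, possibly infinite, but
   the voters actually present form a finite set.  In the networks below the
   vertex None is the moderator and Some i is voter i, so that the moderator
   is not a voter and is never a child. *)

Definition edge (V : choiceType) (rm : {fset V}) (r : V -> {fset V}) :
    rel (option V) :=
  fun u v =>
    match u, v with
    | None, Some j => j \in rm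
    | Some i, Some j => j \in r i
    | _, None => false
    end.

(* s lists the vertices of a directed walk from the moderator to voter i,
   the moderator itself being omitted: size s is the number of edges. *)
Definition walk_to (V : choiceType) (rm : {fset V}) (r : V -> {fset V})
    (i : V) (s : seq (option V)) : Prop :=
  path (edge rm r) None s /\ last None s = Some i.

(* The directed trees with root m are the graphs with exactly one directed walk
   from m to each vertex; walks rather than simple paths, so that cycles are
   excluded.  The values of r outside N are irrelevant, as no walk from m
   leaves N. *)
Definition social_network (V : choiceType) (N rm : {fset V})
    (r : V -> {fset V}) : Prop :=
  [/\ rm `<=` N,
      (forall i, i \in N -> r i `<=` N `\ i) &
      (forall i, i \in N -> exists! s, walk_to rm r i s)].

Definition at_distance (V : choiceType) (rm : {fset V}) (r : V -> {fset V})
    (d : nat) (i : V) : Prop :=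
  exists2 s, walk_to rm r i s & size s = d.

Definition voter_type (R : realType) (V : choiceType) : Type :=
  (preference R * {fset V})%type.

Definition profile (R : realType) (V : choiceType) : Type :=
  V -> voter_type R V.

Definition children (R : realType) (V : choiceType) (theta : profile R V) :
    V -> {fset V} :=
  fun i => (theta i).2.

Definition can_report (R : realType) (V : choiceType)
    (ti ti' : voter_type R V) : Prop :=
  ti'.2 `<=` ti.2.

Definition participates (R : realType) (V : choiceType) (rm : {fset V})
    (theta : profile R V) (i : V) : Prop :=
  exists s, walk_to rm (children theta) i s.

(* The moderator knows her own children, so the rule may depend on rm.  The
   locality condition says that only the reports of the participating voters
   are used; it also makes the values of a profile at absent voters
   irrelevant, which is why profiles are total functions on V. *)
Record scf (R : realType) (V : choiceType) : Type := SCF {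
  scf_fun :> {fset V} -> profile R V -> outcome R;
  scf_local : forall (rm : {fset V}) (theta theta' : profile R V),
    (forall i, participates rm theta i -> theta i = theta' i) ->
    scf_fun rm theta = scf_fun rm theta' }.

(* Here theta is the true profile, theta' i is the report of i compared with
   the truth, and the other values of theta' are the reports of the others. *)
Definition strategy_proof (R : realType) (V : choiceType) (f : scf R V) :
    Prop :=
  forall (N rm : {fset V}) (theta theta' : profile R V) (i : V),
    social_network N rm (children theta) -> i \in N ->
    (forall j, j \in N -> can_report (theta j) (theta' j)) ->
    (theta i).1 (f rm [eta theta' with i |-> theta i]) (f rm theta').

Definition pareto_efficient (R : realType) (V : choiceType) (f : scf R V) :
    Prop :=
  forall (N rm : {fset V}) (theta : profile R V),
    social_network N rm (children theta) ->
    ~ exists o : outcome R,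
        (forall i, participates rm theta i ->
           (theta i).1 o (f rm theta)) /\
        (exists i, participates rm theta i /\
           strict (theta i).1 o (f rm theta)).

Definition anonymous_on_distances (R : realType) (V : choiceType)
    (f : scf R V) : Prop :=
  forall (N rm : {fset V}) (theta : profile R V) (d : nat) (S : {fset V})
      (sigma : V -> V),
    social_network N rm (children theta) ->
    (forall i, i \in S -> at_distance rm (children theta) d i) ->
    bijective sigma -> (forall i, i \notin S -> sigma i = i) ->
    f rm theta = f rm (fun i => ((theta (sigma i)).1, (theta i).2)).

(* Voter relevance in the given social network (N, rm, r): the true children
   sets are those of r, so the other voters' actions are the reports theta'
   whose children sets are contained in those of r. *)
Definition voter_relevant (R : realType) (V : choiceType) (d : nat)
    (N rm : {fset V}) (r : V -> {fset V}) (f : scf R V) : Prop :=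
  forall (i : V) (d' : nat), i \in N -> (1 <= d' <= d)%N ->
    at_distance rm r d' i ->
    forall ti : voter_type R V, ti.2 = r i ->
    exists theta' : profile R V,
      (forall j, j \in N -> j != i -> (theta' j).2 `<=` r j) /\
      exists ti' ti'' : voter_type R V,
        [/\ can_report ti ti', can_report ti ti'' &
            f rm [eta theta' with i |-> ti'] <>
            f rm [eta theta' with i |-> ti'']].

(* Main.v *)
Require Import Defs.
From mathcomp Require Import all_boot all_order all_algebra.
From mathcomp Require Import finmap reals.
From mathcomp Require Import boolp.
From mathcomp Require Import lra.

(** Write theta0 for the profile theta with all invitations removed, so that
    only the children of the moderator participate.  Then f theta = f theta0,
    so no voter at distance 2 or more ever matters.  By induction it suffices
    to let one voter a at distance 1 hide her children.  By SP, the outcome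
    x = f theta is weakly better for a than y = f theta0; and since AN-D lets
    us give a the preference of any other voter at distance 1 without changing
    x or y, x is weakly better than y for every voter at distance 1.  By PE at
    theta0 all of them are indifferent between x and y, and if x <> y then by
    single-peakedness all of them strictly prefer the midpoint of x and y to
    y, contradicting PE at theta0. *)

Set Implicit Arguments.
Unset Strict Implicit.
Unset Printing Implicit Defensive.

Import Order.TTheory GRing.Theory Num.Theory.

Local Open Scope ring_scope.
Local Open Scope fset_scope.

Section Networks.
Variable V : choiceType.
Implicit Types (N rm : {fset V}) (r : V -> {fset V}).

Lemma walk_to_child rm r i : i \in rm -> walk_to rm r i [:: Some i].
Proof. by move=> irm; split=> //=; rewrite irm. Qed.

Lemma walk_to_rcons rm r i j s :
  walk_to rm r i s -> j \in r i -> walk_to rm r j (rcons s (Some j)).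
Proof. by case=> ps ls jri; split; rewrite ?last_rcons// rcons_path ps ls. Qed.

Lemma walk_to_childless rm r i s :
  (forall j, j \in rm -> r j = fset0) -> walk_to rm r i s -> i \in rm.
Proof.
move=> r0 []; case: s => [|[j|] [|[k|] s]] //=.
- by rewrite andbT => jrm [<-].
- by case/and3P=> jrm; rewrite (r0 j jrm) in_fset0.
- by rewrite !andbF.
Qed.

Lemma walk_to_sub N rm r r' i s : social_network N rm r ->
    (forall j, j \in N -> r' j `<=` r j) ->
  walk_to rm r' i s -> walk_to rm r i s /\ i \in N.
Proof.
move=> [/fsubsetP rmN rN _] r'r [].
(* The inclusion of [r' j] in [r j] is known only for [j] in [N], so the induction also carries that
   the walk stays in [N]. *)
pose present u := if u is Some j then j \in N else true.
suff path_sub u : present u -> path (edge rm r') u s ->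
    path (edge rm r) u s /\ present (last u s).
  by case/(path_sub None isT)=> ps + ls; rewrite ls.
elim: s u => [|v s IHs] u uN //= /andP[uv ps].
have [uv' vN] : edge rm r u v /\ present v.
  case: u v uN uv {IHs ps} => [j|] [k|] //= jN.
    move=> /(fsubsetP (r'r j jN)) kr; split=> //.
    by have /fsubsetP/(_ _ kr) := rN j jN; rewrite in_fsetD1 => /andP[].
  by move=> krm; split=> //; exact: rmN.
by have [-> lN] := IHs v vN ps; rewrite uv'.
Qed.

(** Removing edges creates no new walks, so uniqueness survives, but it may cut voters off: the
    vertex set must shrink to those still reachable. This lets PE, AN-D and SP be applied to
    networks formed by reports. *)
Lemma social_network_sub N rm r r' : social_network N rm r ->
    (forall i, i \in N -> r' i `<=` r i) ->
  exists N', social_network N' rm r'.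
Proof.
move=> hG r'r; have [/fsubsetP rmN rN walkN] := hG.
exists [fset i in N | `[< exists s, walk_to rm r' i s >]]; split.
- apply/fsubsetP => i irm; rewrite !inE /= (rmN _ irm) /=.
  by apply/asboolP; exists [:: Some i]; exact: walk_to_child.
- move=> i; rewrite !inE /= => /andP[iN /asboolP[s ws]].
  apply/fsubsetP => j jr'; have /fsubsetP/(_ _ jr') jr := r'r i iN.
  have /fsubsetP/(_ _ jr) := rN i iN; rewrite !inE /= => /andP[-> ->] /=.
  by apply/asboolP; exists (rcons s (Some j)); exact: walk_to_rcons ws _.
- move=> i; rewrite !inE /= => /andP[iN /asboolP[s ws]].
  exists s; split=> // t wt; have [u [_ uniq_u]] := walkN i iN.
  rewrite -(uniq_u s) ?(uniq_u t)//.
    by case: (walk_to_sub hG r'r wt).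
  by case: (walk_to_sub hG r'r ws).
Qed.

(** A child of the moderator already has a walk of length 1, and walks are unique. *)
Lemma at_distance2_notin N rm r i : social_network N rm r -> i \in N ->
  at_distance rm r 2 i -> i \notin rm.
Proof.
move=> [_ _ walkN] iN [s ws s2]; apply/negP => irm.
have [u [_ uniq_u]] := walkN i iN.
by move: s2; rewrite -(uniq_u s ws) (uniq_u _ (walk_to_child r irm)).
Qed.

End Networks.

Section Preferences.
Variable R : realType.

(** Wherever the peak lies, moving from [o] away from it leads to [x] or to [y]. So [o] strictly
    beats one of them, and by indifference also the other. *)
Lemma between_indifferent (p : preference R) (x y : outcome R) : x <> y ->
    p x y -> p y x ->
  forall o : outcome R, val x < val o < val y \/ val y < val o < val x ->
  strict p o y.
Proof.
move=> xy pxy pyx o o_btw.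
have ox : val o != val x by apply/eqP; lra.
have oy : val o != val y by apply/eqP; lra.
have [c cP] := preference_single_peaked p.
suff [[pox nxo]|//] : strict p o x \/ strict p o y.
  split; first exact: preference_transitive pox pxy.
  by move=> pyo; apply: nxo; exact: preference_transitive pxy pyo.
have cx := cP o x; have cy := cP o y.
have {}cx := cx (fun e => negP ox (introT eqP (congr1 val e))).
have {}cy := cy (fun e => negP oy (introT eqP (congr1 val e))).
have [co|oc] := leP (val c) (val o); case: o_btw => /andP[o1 o2].
- by right; apply: cy; left.
- by left; apply: cx; left.
- by left; apply: cx; right; split=> //; exact: ltW.
- by right; apply: cy; right; split=> //; exact: ltW.
Qed.

Lemma outcome_between (x y : outcome R) : x <> y ->
  exists o : outcome R, val x < val o < val y \/ val y < val o < val x.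
Proof.
move=> xy; have vxy : val x != val y by apply/eqP => /val_inj.
have [x01 y01] := (valP x, valP y).
have o01 : (val x + val y) / 2 \in `[0%R, 1%R].
  by move: x01 y01; rewrite !in_itv /=; lra.
exists (exist (fun z : R => z \in `[0%R, 1%R]) _ o01).
move: vxy; rewrite [val (exist _ _ _)]/= neq_lt => /orP[] /midf_lt[].
  by left; apply/andP.
by rewrite addrC; right; apply/andP.
Qed.

Lemma preference_inhabited : inhabited (preference R).
Proof.
have z01 : (0 : R) \in `[0%R, 1%R] by rewrite in_itv /= lexx ler01.
(* The preference for smaller outcomes, with peak 0. *)
have sp : single_peaked (fun x y : outcome R => val x <= val y : Prop).
  exists (exist (fun z : R => z \in `[0%R, 1%R]) 0 z01) => x y _ [[_ xy]|[yx x0]].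
    by split; [exact: ltW | apply/negP; rewrite -ltNge].
  have := valP y; rewrite in_itv /= => /andP[y0 _].
  by have := lt_le_trans (le_lt_trans y0 yx) x0; rewrite ltxx.
constructor; apply: Preference sp.
- by move=> x y; apply/orP; exact: le_total.
- by move=> x y z; exact: le_trans.
Qed.

End Preferences.

Section Rules.
Variables (R : realType) (V : choiceType) (f : scf R V).
Hypotheses (f_sp : strategy_proof f) (f_pe : pareto_efficient f).
Hypothesis f_an : anonymous_on_distances f.
Implicit Types (N rm : {fset V}) (theta : profile R V).

Definition without_children theta : profile R V := fun i => ((theta i).1, fset0).

Definition permute_preferences (sigma : V -> V) theta : profile R V :=
  fun i => ((theta (sigma i)).1, (theta i).2).

Definition transpose (a b i : V) : V :=
  if i == a then b else if i == b then a else i.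

Lemma transposeK a b : involutive (transpose a b).
Proof.
by move=> i; rewrite /transpose; do !case: eqP => //; congruence.
Qed.

Lemma scf_transpose N rm theta a b : social_network N rm (children theta) ->
    a \in rm -> b \in rm ->
  f rm theta = f rm (permute_preferences (transpose a b) theta).
Proof.
move=> hG arm brm; apply: (f_an (d := 1) (S := [fset a; b]) hG).
- move=> i; rewrite !inE => iab; exists [:: Some i] => //.
  by apply: walk_to_child; case/orP: iab => /eqP ->.
- by exists (transpose a b); exact: transposeK.
- by move=> i; rewrite !inE negb_or /transpose => /andP[/negPf-> /negPf->].
Qed.

Lemma scf_ext rm theta theta' : theta =1 theta' -> f rm theta = f rm theta'.
Proof. by move=> e; apply: scf_local => i _. Qed.

Lemma without_children_network N rm theta : social_network N rm (children theta) ->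
  exists N', social_network N' rm (children (without_children theta)).
Proof. by move=> hG; apply: social_network_sub hG _ => i _; exact: fsub0set. Qed.

Lemma participates_without_children rm theta i :
  participates rm (without_children theta) i <-> i \in rm.
Proof.
split=> [[s]|irm]; first exact: walk_to_childless.
by exists [:: Some i]; exact: walk_to_child.
Qed.

Lemma pareto_without_children N rm theta (x : outcome R) a :
    social_network N rm (children theta) -> a \in rm ->
    (forall j, j \in rm -> (theta j).1 x (f rm (without_children theta))) ->
  x = f rm (without_children theta).
Proof.
move=> hG arm; set y := f rm _ => xy.
have [N' /f_pe pe] := without_children_network hG.
(* A child of the moderator who strictly preferred [x] would make [x] itself a Pareto improvement on
   [y]. *)
have yx j : j \in rm -> (theta j).1 y x.
  move=> jrm; apply: contrapT => nyx; apply: pe; exists x; split.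
    by move=> i /participates_without_children; exact: xy.
  exists j; split; first exact/participates_without_children.
  by split; [exact: xy | exact: nyx].
apply: contrapT => x_neq_y; have [o o_btw] := outcome_between x_neq_y.
have o_better j : j \in rm -> strict (theta j).1 o y.
  by move=> jrm; apply: between_indifferent o_btw; [|exact: xy|exact: yx].
apply: pe; exists o; split=> [i /participates_without_children irm|].
  by case: (o_better i irm).
by exists a; split; [exact/participates_without_children | exact: o_better].
Qed.

Lemma scf_without_children N rm theta : social_network N rm (children theta) ->
  f rm theta = f rm (without_children theta).
Proof.
(* Induction on the number of children of the moderator who still report children. Voters further
   down need not be counted: once this number is 0, none of them participates. *)
have [n] := ubnP #|` [fset i in rm | (theta i).2 != fset0]|.
elim: n => // n IHn in N theta *; rewrite ltnS => le_n hG.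
have [[a [arm ca]]|childless] :=
    pselect (exists a, a \in rm /\ (theta a).2 != fset0); last first.
  have r0 j : j \in rm -> children theta j = fset0.
    by move=> jrm; apply/eqP/negPn/negP => cj; apply: childless; exists j.
  apply: scf_local => i [s /(walk_to_childless r0) irm].
  by rewrite /without_children -(r0 i irm) /children; case: (theta i).
apply: (pareto_without_children hG arm) => j jrm.
(* In [theta1] voter [a] holds the preference of [j]; in [theta2] she moreover hides her children.
   SP with true profile [theta1] then compares the two outcomes by the preference of [j]. *)
set theta1 := permute_preferences (transpose a j) theta.
set theta2 : profile R V := [eta theta1 with a |-> ((theta1 a).1, fset0)].
have sub2 i : children theta2 i `<=` children theta1 i.
  by rewrite /children /theta2 /=; case: eqP; rewrite ?fsub0set ?fsubset_refl.
have [N2 hG2] := social_network_sub (r' := children theta2) hG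
  (fun i _ => sub2 i).
have aN : a \in N by case: hG => /fsubsetP/(_ a arm).
have := @f_sp N rm theta1 theta2 a hG aN (fun i _ => sub2 i).
have -> : (theta1 a).1 = (theta j).1 by rewrite /= /transpose eqxx.
have -> : f rm [eta theta2 with a |-> theta1 a] = f rm theta.
  rewrite (scf_transpose hG arm jrm); apply: scf_ext => i.
  by rewrite /theta2 /=; case: (i =P a) => [->|].
suff -> : f rm theta2 = f rm (without_children theta) by [].
(* In [theta2] voter [a] leaves the counted set, so the induction hypothesis applies. *)
rewrite (IHn N2)//; last first.
  apply: leq_trans le_n; apply: fproper_ltn_card; rewrite fproperE.
  apply/andP; split; [apply/fsubsetP => i |apply/fsubsetPn].
    by rewrite !inE /theta2 /=; case: (i =P a) => [_|//]; rewrite eqxx andbF.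
  by exists a; rewrite !inE /theta2 /= arm ?eqxx.
(* Without children, [theta2] is [theta] with the preferences of [a] and [j] swapped, which AN-D
   ignores. *)
have [N0 hG0] := without_children_network hG.
rewrite (scf_transpose hG0 arm jrm); apply: scf_ext => i.
by rewrite /without_children /permute_preferences /theta2 /=; case: (i =P a) => [->|].
Qed.

End Rules.

Theorem theorem3 (R : realType) (V : choiceType) (N rm : {fset V})
    (r : V -> {fset V}) (hG : social_network N rm r)
    (h2 : exists i : V, i \in N /\ at_distance rm r 2 i) :
  ~ exists f : scf R V,
      [/\ strategy_proof f, pareto_efficient f, anonymous_on_distances f
        & voter_relevant 2 N rm r f].
Proof.
case=> f [f_sp f_pe f_an f_vr]; case: h2 => i [iN di].
have [p] := preference_inhabited R.
(* The preference [p] is arbitrary: [can_report] restricts only the reported children. *)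
have [theta [theta_r [t [t' [tr t'r]]]]] := f_vr i 2 iN isT di (p, r i) erefl.
apply.
have report_network u : u.2 `<=` r i ->
    exists N', social_network N' rm (children [eta theta with i |-> u]).
  move=> ur; apply: social_network_sub hG _ => j jN; rewrite /children /=.
  by case: eqVneq => [->//|]; exact: theta_r.
have [N1 hG1] := report_network t tr.
have [N2 hG2] := report_network t' t'r.
(* With all children removed, the two profiles differ at most at [i], who no longer participates. *)
rewrite (scf_without_children f_sp f_pe f_an hG1) (scf_without_children f_sp f_pe f_an hG2).
apply: scf_local => j /participates_without_children jrm; rewrite /without_children /=.
by case: eqP => // ji; move: (at_distance2_notin hG iN di); rewrite -ji jrm.
Qed.
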